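(* For every integer $n\ge1$ and every $T$ with $0\le T<T_0=\frac1{2^{n-3}+1}$, we have $\lambda^{\mathcal I_{n,T}}=\frac1n$.
   Context: Problem (OPTiWinD on the segment): a vehicle starts at position $0$ at time $0$ and moves in $[-1,1]$ at speed at most $1$. A request is a triple $(A,[r,r+2],\delta)$ with location $A\in[-1,1]$, release time $r\ge0$ and weight $\delta>0$; it is served if the vehicle is at $A$ at some time in $[r,r+2]$. For an integer $n\ge1$ and $T\ge0$, $\mathcal I_{n,T}$ is the set of instances consisting of at most $n$ requests such that the release times of any two successive requests differ by at least $T$. An online algorithm learns each request (location and weight) only at its release time and does not know the number of requests in advance; its movement up to time $t$ depends only on the requests released up to time $t$. For an instance $I$ and algorithm $ALG$, the performance $\lambda^I_{ALG}$ is the total weight of served requests divided by the total weight of all requests. Define $\lambda^{\mathcal I_{n,T}}_{ALG}=\inf_{I\in\mathcal I_{n,T}}\lambda^I_{ALG}$ and $\lambda^{\mathcal I_{n,T}}=\sup_{ALG}\lambda^{\mathcal I_{n,T}}_{ALG}$, the supremum over online algorithms. *)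

(* Defs.v *)
From HB Require Import structures.
From mathcomp Require Import all_boot all_order all_algebra.
From mathcomp Require Import boolp classical_sets reals.

Set Implicit Arguments.
Unset Strict Implicit.
Unset Printing Implicit Defensive.

Import Order.TTheory GRing.Theory Num.Theory.
Local Open Scope classical_set_scope.
Local Open Scope ring_scope.

Record request (R : realType) := Request {
  location : R;
  release : R;
  weight : R }.

Definition request_valid (R : realType) (q : request R) : bool :=
  [&& -1 <= location q <= 1, 0 <= release q & 0 < weight q].

(* A finite input, listed in order of release.  Simultaneous requests may be
   listed in any order. *)
Definition input_valid (R : realType) (I : seq (request R)) : bool :=
  all (@request_valid R) I &&
  sorted (fun p q => release p <= release q) I.

(* The class I_{n,T}.  The empty input is left out because its performance
   would be 0 / 0. *)
Definition instances (R : realType) (n : nat) (T : R) :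
    set (seq (request R)) :=
  [set I | [/\ input_valid I, (0 < size I <= n)%N &
               sorted (fun p q => T <= release q - release p) I]].

(* Only the values at times t >= 0 are meaningful. *)
Definition trajectory (R : realType) (x : R -> R) : Prop :=
  [/\ x 0 = 0,
      forall t, 0 <= t -> -1 <= x t <= 1 &
      forall s t, 0 <= s -> 0 <= t -> `|x t - x s| <= `|t - s|].

Definition served (R : realType) (x : R -> R) (q : request R) : Prop :=
  exists2 t, release q <= t <= release q + 2 & x t = location q.

Definition released_by (R : realType) (t : R) (I : seq (request R)) :
    seq (request R) :=
  [seq q <- I | release q <= t].

(* An algorithm maps each input to the trajectory it produces on that input;
   it is online when the trajectory on [0, t] is the same on any two inputs
   with the same requests released up to time t. *)
Definition online_algorithm (R : realType) :
    set (seq (request R) -> R -> R) :=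
  [set alg |
    (forall I, input_valid I -> trajectory (alg I)) /\
    (forall I J t, input_valid I -> input_valid J ->
       released_by t I = released_by t J ->
       forall s, 0 <= s <= t -> alg I s = alg J s)].

Definition performance (R : realType) (alg : seq (request R) -> R -> R)
    (I : seq (request R)) : R :=
  (\sum_(q <- I | `[< served (alg I) q >]) weight q) /
  (\sum_(q <- I) weight q).

(* For n >= 1 the sets below are nonempty and contained in [0, 1], so the
   default values of [inf] and [sup] on R play no role. *)
Definition alg_value (R : realType) (n : nat) (T : R)
    (alg : seq (request R) -> R -> R) : R :=
  inf [set performance alg I | I in instances n T].

Definition opt_value (R : realType) (n : nat) (T : R) : R :=
  sup [set alg_value n T alg | alg in @online_algorithm R].

(* Main.v *)
Require Import Defs.
From HB Require Import structures.
From mathcomp Require Import all_boot all_order all_algebra.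
From mathcomp Require Import boolp classical_sets reals.
From mathcomp Require Import lra.

Set Implicit Arguments.
Unset Strict Implicit.
Unset Printing Implicit Defensive.

Import Order.TTheory GRing.Theory Num.Theory.
Local Open Scope ring_scope.

(* Chasing each new request that is heavier than all earlier ones serves the
   heaviest request, because the whole segment can be crossed in the time 2 for
   which a request stays open; this gives 1/n.

   Conversely, the adversary uses unit weights.  It releases a request at 1 at
   time 0 and one at -1 at time T.  An algorithm that never reaches an endpoint
   serves nothing.  Otherwise the adversary watches for the first moment at
   which the vehicle is within a small distance d of an endpoint a, and then
   releases a request at -a.  If more than d has passed since the previous
   release, the older requests at -a are already lost, and those at a and -a
   cannot both be served.  A vehicle at distance more than 2d and d + T from the
   endpoints at one release lets the next release be made at distance d, at
   least T later, so n - 2 further rounds are possible when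
   1 - T > 2^(n-3) T, which is T < T_0 (for n >= 3). *)

(** * Continuity and first hitting times of trajectories *)

Lemma trajectory_le (R : realType) (x : R -> R) (s t : R) :
  trajectory x -> 0 <= s -> s <= t -> `|x t - x s| <= t - s.
Proof.
move=> [_ _ lip] s0 st; rewrite -[leRHS]ger0_norm ?subr_ge0//.
by apply: lip => //; exact: le_trans st.
Qed.

(** Both paths are 1-Lipschitz, hence continuous. Onlineness gives agreement only strictly before
    the next release; this extends it to the release itself. *)
Lemma trajectory_eq_left (R : realType) (x y : R -> R) (u : R) :
  trajectory x -> trajectory y -> 0 < u ->
  (forall t, 0 <= t < u -> x t = y t) -> x u = y u.
Proof.
move=> tx ty u0 xy; apply/eqP; rewrite -subr_eq0 -normr_le0.
apply/ler_addgt0Pr => d d0; rewrite add0r.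
pose t := Num.max 0 (u - d / 2).
have t0 : 0 <= t by rewrite le_max lexx.
have tu : t < u by rewrite gt_max u0; lra.
have td : u - d / 2 <= t by rewrite le_max lexx orbT.
have xyt : x t = y t by apply: xy; rewrite t0.
have := trajectory_le tx t0 (ltW tu); have := trajectory_le ty t0 (ltW tu).
rewrite xyt !ler_norml; lra.
Qed.

(** Take for [u] the infimum of the times after [s] with [c <= |x v|]; the Lipschitz bound excludes
    overshoot and undershoot there. *)
Lemma trajectory_first_hit (R : realType) (x : R -> R) (c s t : R) :
  trajectory x -> 0 <= s -> s <= t -> `|x s| < c -> c <= `|x t| ->
  exists u, [/\ s <= u, `|x u| = c & forall v, s <= v < u -> `|x v| < c].
Proof.
move=> tx s0 st xs xt.
pose E := [set v | s <= v /\ c <= `|x v|]%classic.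
have hE : has_inf E by split; [exists t | exists s => v [sv _]].
have sE : s <= inf E by apply: lb_le_inf; [exact: hE.1 | move=> v [sv _]].
have before v : s <= v < inf E -> `|x v| < c.
  move=> /andP[sv vE]; rewrite ltNge; apply/negP => cv.
  by have := ge_inf hE.2 (conj sv cv : E v); rewrite leNgt vE.
exists (inf E); split => //; apply/le_anti/andP; split; rewrite leNgt; apply/negP => h.
- have sltE : s < inf E.
    by rewrite lt_neqAle sE andbT; apply/eqP => sE'; move: h xs; rewrite -sE'; lra.
  pose d := `|x (inf E)| - c; pose w := Num.max s (inf E - d / 2).
  have d0 : 0 < d by rewrite subr_gt0.
  have sw : s <= w by rewrite le_max lexx.
  have wE : w < inf E by rewrite gt_max sltE; lra.
  have wd : inf E - d / 2 <= w by rewrite le_max lexx orbT.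
  have xw : `|x w| < c by apply: before; rewrite sw.
  have := trajectory_le tx (le_trans s0 sw) (ltW wE).
  have := lerB_dist (x (inf E)) (x w).
  rewrite /d in wd d0; lra.
- have d0 : 0 < c - `|x (inf E)| by rewrite subr_gt0.
  have [v [sv cv] vE] := inf_adherent d0 hE.
  have Ev := ge_inf hE.2 (conj sv cv : E v).
  have := trajectory_le tx (le_trans s0 sE) Ev.
  have := lerB_dist (x v) (x (inf E)); lra.
Qed.

(** * The chasing strategy and the lower bound *)

Definition chase (R : realType) (x : R -> R) (r a t : R) : R :=
  if t <= r then x t
  else if x r <= a then Num.min (x r + (t - r)) a else Num.max (x r - (t - r)) a.

Lemma trajectory_chase (R : realType) (x : R -> R) (r a : R) :
  trajectory x -> 0 <= r -> -1 <= a <= 1 -> trajectory (chase x r a).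
Proof.
move=> tx r0 a1; have [x0 xb lip] := tx; split.
- by rewrite /chase r0.
- move=> t t0; rewrite /chase; have [_|rt] := leP t r; first exact: xb.
  have := xb r r0; have [xa|xa] := leP (x r) a.
    by have [|] := leP (x r + (t - r)) a; lra.
  by have [|] := leP (x r - (t - r)) a; lra.
- move=> s t; wlog st : s t / s <= t => [hw s0 t0|s0 t0].
    have [st|/ltW ts] := leP s t; first exact: hw.
    by rewrite distrC [leRHS]distrC; exact: hw.
  rewrite [leRHS]ger0_norm ?subr_ge0// /chase.
  have [tr|rt] := leP t r.
    by rewrite (le_trans st tr); exact: trajectory_le.
  have [sr|rs] := leP s r.
    have := trajectory_le tx s0 sr; rewrite !ler_norml.
    have [xa|xa] := leP (x r) a.
      by have [|] := leP (x r + (t - r)) a; lra.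
    by have [|] := leP (x r - (t - r)) a; lra.
  rewrite ler_norml; have [xa|xa] := leP (x r) a.
    by have [|] := leP (x r + (t - r)) a; have [|] := leP (x r + (s - r)) a; lra.
  by have [|] := leP (x r - (t - r)) a; have [|] := leP (x r - (s - r)) a; lra.
Qed.

Lemma chase_reaches (R : realType) (x : R -> R) (r a : R) :
  trajectory x -> 0 <= r -> -1 <= a <= 1 ->
  exists2 t, r <= t <= r + 2 & chase x r a t = a.
Proof.
move=> tx r0 a1; have [_ xb _] := tx; have := xb r r0 => xr.
have [xa|xa] := eqVneq (x r) a; first by exists r; [lra | rewrite /chase lexx].
exists (r + `|a - x r|).
  by have : `|a - x r| <= 2 by [rewrite ler_norml; lra]; have := normr_ge0 (a - x r); lra.
have d0 : 0 < `|a - x r| by rewrite normr_gt0 subr_eq0 eq_sym.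
rewrite /chase leNgt ltrDl d0 /= [r + _]addrC addrK.
have [h|h] := leP (x r) a.
  by rewrite ger0_norm ?subr_ge0// addrC subrK minxx.
by rewrite ltr0_norm ?subr_lt0// opprK addrC subrK maxxx.
Qed.

Lemma sum_weight_ge0 (R : realType) (P : pred (request R)) (I : seq (request R)) :
  all (@request_valid R) I -> 0 <= \sum_(q <- I | P q) weight q.
Proof.
elim: I => [|q I IH]; first by rewrite big_nil.
rewrite big_cons => /= /andP[/and3P[_ _ wq] /IH].
by case: ifP => // _; apply: addr_ge0; exact: ltW.
Qed.

Lemma total_weight_gt0 (R : realType) (I : seq (request R)) :
  all (@request_valid R) I -> (0 < size I)%N -> 0 < \sum_(q <- I) weight q.
Proof.
case: I => // q I /= /andP[/and3P[_ _ wq] vI] _; rewrite big_cons.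
by rewrite ltr_pwDl// sum_weight_ge0.
Qed.

Lemma instances_nonempty (R : realType) (n : nat) (T : R) :
  (1 <= n)%N -> (instances n T !=set0)%classic.
Proof.
move=> n1; exists [:: Request 0 0 1]; split=> //.
by rewrite /input_valid /= /request_valid /= lexx ltr01 andbT; lra.
Qed.

(** The state pairs the path planned so far with the largest weight seen so far. *)
Definition greedy_step (R : realType) (xw : (R -> R) * R) (q : request R) :
    (R -> R) * R :=
  if xw.2 < weight q then (chase xw.1 (release q) (location q), weight q) else xw.

Definition greedy (R : realType) (I : seq (request R)) : (R -> R) * R :=
  foldl (@greedy_step R) (fun=> 0, 0) I.

Lemma greedy_rcons (R : realType) (I : seq (request R)) q :
  greedy (rcons I q) = greedy_step (greedy I) q.
Proof. by rewrite /greedy foldl_rcons. Qed.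

Lemma trajectory_greedy (R : realType) (I : seq (request R)) :
  all (@request_valid R) I -> trajectory (greedy I).1.
Proof.
elim/last_ind: I => [_|I q IH].
  by split => //= [t _|s t _ _]; [lra | rewrite subr0 normr0].
rewrite all_rcons greedy_rcons => /andP[/and3P[lq rq _]] /IH tI.
by rewrite /greedy_step; case: ifP => //= _; exact: trajectory_chase.
Qed.

(** Induction on the last request: a new record is served by the new path and alone accounts for the
    new maximum, whatever is lost; any other request leaves the path unchanged. *)
Lemma served_weight_heaviest (R : realType) (I : seq (request R)) :
  all (@request_valid R) I -> 
  [/\ 0 <= (greedy I).2,
   (greedy I).2 <= \sum_(q <- I | `[< served (greedy I).1 q >]) weight q &
   \sum_(q <- I) weight q <= (size I)%:R * (greedy I).2].
Proof.
elim/last_ind: I => [_|I q IH].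
  by rewrite !big_nil mul0r.
rewrite all_rcons greedy_rcons size_rcons => /andP[/and3P[lq rq wq]] vI.
have [w0 sw tw] := IH vI; have tI := trajectory_greedy vI.
have sum_ge0 := fun P => sum_weight_ge0 P vI.
rewrite /greedy_step !big_rcons -natr1 mulrDl mul1r; case: ltP => /= hw; split.
- exact: ltW.
- have -> : `[< served (chase (greedy I).1 (release q) (location q)) q >].
    by apply/asboolP; exact: chase_reaches.
  by rewrite lerDr.
- by rewrite lerD2r (le_trans tw)// ler_wpM2l// ltW.
- by [].
- by apply: le_trans sw _; rewrite lerDl; case: ifP => _ //; exact: ltW.
- exact: lerD.
Qed.

(** Chasing a request alters the path only after its release. By sortedness, once the last request
    is released by [t], so are all others. *)
Lemma greedy_released_by (R : realType) (I : seq (request R)) (s t : R) :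
  sorted (fun p q => release p <= release q) I -> s <= t ->
  (greedy (released_by t I)).1 s = (greedy I).1 s.
Proof.
have tr : transitive (fun p q : request R => release p <= release q).
  by move=> p q r; exact: le_trans.
move=> + st; rewrite sorted_pairwise//.
elim/last_ind: I => // I q IH; rewrite pairwise_rcons => /andP[Iq /IH eI].
rewrite /released_by filter_rcons; case: leP => [qt|tq].
  congr ((greedy (rcons _ q)).1 s); apply/all_filterP.
  by apply: sub_all Iq => p pq; exact: le_trans qt.
rewrite greedy_rcons /greedy_step [LHS]eI; case: (_ < _) => //=.
by rewrite /chase (le_trans st (ltW tq)).
Qed.

Lemma online_greedy (R : realType) :
  online_algorithm (fun I : seq (request R) => (greedy I).1).
Proof.
split=> [I /andP[vI _]|I J t /andP[_ sI] /andP[_ sJ] IJ s /andP[_ st]].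
  exact: trajectory_greedy.
by rewrite -(greedy_released_by sI st) IJ greedy_released_by.
Qed.

Lemma performance_greedy (R : realType) (n : nat) (T : R) (I : seq (request R)) :
  instances n T I -> 1 / n%:R <= performance (fun J => (greedy J).1) I.
Proof.
move=> [/andP[vI _] /andP[I0 In] _].
have [w0 sw tw] := served_weight_heaviest vI.
have W0 := total_weight_gt0 vI I0.
have n0 : 0 < n%:R :> R by rewrite ltr0n (leq_trans I0).
rewrite /performance ler_pdivlMr// mulrAC ler_pdivrMr// mul1r.
apply: (le_trans tw); rewrite mulrC.
by apply: ler_pM => //; rewrite ler_nat.
Qed.

(** * One round of the adversary *)

Lemma sorted_rcons2 (A : Type) (e : rel A) (J : seq A) (p q : A) :
  sorted e (rcons (rcons J p) q) = sorted e (rcons J p) && e p q.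
Proof. by case: J => [|a J] /=; rewrite ?andbT// !rcons_path last_rcons. Qed.

(** Taken for an arbitrary path, since [trapped] quantifies over all continuations of the current
    one. *)
Definition served_weight (R : realType) (x : R -> R) (I : seq (request R)) : R :=
  \sum_(q <- I | `[< served x q >]) weight q.

(* The last released request [q] sits at an endpoint.  The vehicle, still at
   distance more than [e] from both endpoints, can serve weight at most 1 of the
   earlier requests [J], and doing so takes it to the endpoint opposite to [q]
   before [q] expires. *)
Definition trapped (R : realType) (T : R) (alg : seq (request R) -> R -> R)
    (e : R) (J : seq (request R)) (q : request R) : Prop :=
  let x := alg (rcons J q) in
  [/\ instances (size J).+1 T (rcons J q),
      \sum_(p <- rcons J q) weight p = (size J).+1%:R,
      `|location q| = 1 /\ weight q = 1,
      `|x (release q)| < 1 - e &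
      forall y, trajectory y ->
        (forall t, 0 <= t <= release q -> y t = x t) ->
        served_weight y J <= 1 /\
        (0 < served_weight y J ->
         exists2 t, release q <= t <= release q + 2 & y t = - location q)].

Lemma served_weight_rcons (R : realType) (x : R -> R) (J : seq (request R)) q :
  weight q = 1 ->
  (served x q /\ served_weight x (rcons J q) = served_weight x J + 1) \/
  (~ served x q /\ served_weight x (rcons J q) = served_weight x J).
Proof.
move=> wq; rewrite /served_weight big_rcons /= wq.
by case: asboolP => h; [left | right]; rewrite ?addr0.
Qed.

Lemma norm1_cases (R : realDomainType) (a : R) : `|a| = 1 -> a = 1 \/ a = -1.
Proof. by case: ger0P => _ h; [left | right]; lra. Qed.

(** Serving [q] means visiting its endpoint, and serving earlier weight forces a visit to the
    opposite one. *)
Lemma trapped_serves (R : realType) (T : R) alg (e : R) (J : seq (request R)) q :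
  online_algorithm alg -> trapped T alg e J q ->
  0 < served_weight (alg (rcons J q)) (rcons J q) ->
  exists2 t, release q <= t & `|alg (rcons J q) t| = 1.
Proof.
move=> [talg _] [[vI _ _] _ [lq wq] _ H].
have [H1 H2] := H _ (talg _ vI) (fun _ _ => erefl).
have [[[t /andP[st _] xt] _]|[_ ->] /H2[t /andP[st _] xt]] :=
  served_weight_rcons (alg (rcons J q)) J wq.
  by exists t; rewrite // xt.
by exists t; rewrite // xt normrN.
Qed.

Lemma online_eq_upto (R : realType) alg (I : seq (request R)) (q : request R) :
  online_algorithm alg -> input_valid I -> input_valid (rcons I q) ->
  0 < release q -> forall t, 0 <= t <= release q -> alg (rcons I q) t = alg I t.
Proof.
move=> [talg onl] vI vIq q0.
have lt t : 0 <= t < release q -> alg (rcons I q) t = alg I t.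
  move=> /andP[t0 tq]; apply: (onl _ _ t) => //; last by rewrite t0 lexx.
  by rewrite /released_by filter_rcons leNgt tq.
move=> t /andP[t0]; rewrite le_eqVlt => /orP[/eqP->|tq]; last by rewrite lt ?t0.
by apply: trajectory_eq_left => //; exact: talg.
Qed.

(** The bound [2 * e <= e'] leaves time for older requests to get out of reach, and [e + T <= e']
    keeps releases [T] apart. *)
Lemma trapped_step (R : realType) (T : R) alg (e e' : R) (J : seq (request R)) q :
  online_algorithm alg -> 0 <= T -> 0 <= e -> 2 * e <= e' -> e + T <= e' ->
  trapped T alg e' J q -> 0 < served_weight (alg (rcons J q)) (rcons J q) ->
  exists q', trapped T alg e (rcons J q) q'.
Proof.
move=> oalg T0 e0 ee' eT trap sw.
have [t st xt] := trapped_serves oalg trap sw.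
have talg := oalg.1.
case: trap => [[vI sI gI] wI [lq wq] xs H].
set x := alg (rcons J q) in xt xs H sw.
set s := release q in st xs H.
have tx : trajectory x by exact: talg.
have s0 : 0 <= s.
  by case/andP: vI; rewrite all_rcons => /andP[/and3P[]].
(* The next request comes when the vehicle is first at distance [d] from an
   endpoint, and is placed at the other one. *)
have [d [ed dd dT]] : exists d, [/\ e < d, 2 * d < 1 - `|x s| & d + T <= 1 - `|x s|].
  (* The witness is the midpoint of [e] and the smaller of [1 - |x s| - T] and [(1 - |x s|) / 2]. *)
  have [h|h] := leP (1 - `|x s|) (2 * T).
    by exists ((e + (1 - `|x s| - T)) / 2); split; lra.
  by exists ((e + (1 - `|x s|) / 2) / 2); split; lra.
have [||u [su xu before]] := trajectory_first_hit (c := 1 - d) tx s0 st; try lra.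
have := lerB_dist (x u) (x s); have := trajectory_le tx s0 su; rewrite xu => h1 h2.
(* Closing in from distance [1 - |x s|] to distance [d] takes more than [d] and at least [T]. *)
have sdu : s + d < u by lra.
have sTu : s + T <= u by lra.
have u0 : 0 < u by lra.
have [a [a1 xua]] : exists a, (a = 1 \/ a = -1) /\ x u = - a * (1 - d).
  move: xu; case: ger0P => _ h; [exists (-1) | exists 1].
    by split; [right | lra].
  by split; [left | lra].
have na : `|a| = 1 by case: a1 => ->; rewrite ?normrN normr1.
pose q' := Request a u 1.
have vI' : input_valid (rcons (rcons J q) q').
  case/andP: vI => vI oI; rewrite /input_valid all_rcons vI sorted_rcons2 oI.
  by rewrite /request_valid /= -ler_norml na lexx ltr01 ltW.
exists q'; split.
- split=> //; first by rewrite !size_rcons /= leqnn.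
  by rewrite sorted_rcons2 gI /= lerBrDl.
- by rewrite big_rcons /= wI size_rcons natr1.
- by [].
- rewrite (online_eq_upto oalg) //= ?(ltW u0) ?lexx// -/x xu; lra.
move=> y ty yx'.
have {yx'} yx v : 0 <= v <= u -> y v = x v.
  by move=> vu; rewrite yx' // (online_eq_upto oalg).
(* Endpoints are not visited between [s] and [u], where the distance to them exceeds [d]. *)
have late v b : s <= v -> y v = b -> `|b| = 1 -> u <= v.
  move=> sv yv nb; rewrite leNgt; apply/negP => vu.
  by have := before v; rewrite sv vu -yx ?(le_trans s0 sv) ?(ltW vu)// yv nb; lra.
(* From time [u > s + d], crossing to [a] still takes [2 - d]. *)
have far v : s <= v -> y v = a -> s + 2 < v.
  move=> sv yv; have uv := late _ _ sv yv na.
  have := trajectory_le ty (ltW u0) uv.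
  have yu : y u = - a * (1 - d) by rewrite yx ?(ltW u0) ?lexx.
  by rewrite yv yu ler_norml; case: a1 => ->; lra.
have [H1 H2] : served_weight y J <= 1 /\
    (0 < served_weight y J -> exists2 t, s <= t <= s + 2 & y t = - location q).
  by apply: H => // v /andP[v0 vs]; rewrite yx// v0 (le_trans vs).
have opposite : a = location q \/ a = - location q.
  by case: (norm1_cases lq) => ->; case: a1 => ->; rewrite ?opprK; auto.
(* If [a] is the location of [q], then [q] is lost and any earlier weight leads to [- a]. Otherwise
   the earlier weight is lost, and [q] can only be served at [- a]. *)
case: opposite => ha; case: (served_weight_rcons y J wq) => [[[v /andP[sv vs] yv] ->]|[_ ->]] /=.
- by rewrite -/s in sv vs; move: (far v sv); rewrite yv ha => /(_ erefl); lra.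
- split=> // /H2[v /andP[sv vs] yv]; exists v; last by rewrite ha.
  by have := late v _ sv yv; rewrite normrN lq => /(_ erefl) /=; lra.
- have J0 : served_weight y J <= 0.
    by rewrite leNgt; apply/negP => /H2[w /andP[sw' ws]]; rewrite -ha => /(far w sw'); lra.
  rewrite -/s in sv vs; split; first lra; move=> _; exists v; last by rewrite ha opprK.
  by have := late v _ sv yv lq => /=; lra.
- split=> // /H2[w /andP[sw' ws]]; rewrite -ha => /(far w sw'); lra.
Qed.

(** * The last round and the iteration of rounds *)

(** Serving both [q] and earlier weight would need visits to both endpoints within time 2, starting
    strictly inside the segment. *)
Lemma trapped_end (R : realType) (T : R) alg (J : seq (request R)) q :
  online_algorithm alg -> trapped T alg 0 J q ->
  served_weight (alg (rcons J q)) (rcons J q) <= 1.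
Proof.
move=> [talg _] [[vI _ _] _ [lq wq] xs H].
have ty := talg _ vI; have [H1 H2] := H _ ty (fun _ _ => erefl).
set y := alg (rcons J q) in xs ty H1 H2 *; set s := release q in xs H2.
have s0 : 0 <= s by case/andP: vI; rewrite all_rcons => /andP[/and3P[]].
have [[[v /andP[sv vs] yv] ->]|[_ ->]//] := served_weight_rcons y J wq.
rewrite -/s in sv vs; rewrite gerDr leNgt; apply/negP => /H2[w /andP[sw ws] yw].
have := trajectory_le ty s0 sv; have := trajectory_le ty s0 sw.
move: xs; rewrite subr0 ltr_norml => xs.
have [vw|/ltW wv] := leP v w.
  have := trajectory_le ty (le_trans s0 sv) vw; rewrite yw yv !ler_norml.
  by case: (norm1_cases lq) => ->; lra.
have := trajectory_le ty (le_trans s0 sw) wv; rewrite yw yv !ler_norml.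
by case: (norm1_cases lq) => ->; lra.
Qed.

(* [margin T k] is the distance from the endpoints that lets the adversary
   continue for [k] more rounds. *)
Fixpoint margin (R : realType) (T : R) (k : nat) : R :=
  if k is k'.+1 then Num.max (2 * margin T k') (margin T k' + T) else 0.

Lemma margin_ge0 (R : realType) (T : R) (k : nat) : 0 <= T -> 0 <= margin T k.
Proof.
by move=> T0; elim: k => //= k IH; rewrite le_max mulr_ge0.
Qed.

(** The first step gives [T]; from then on the margin is at least [T], so doubling attains the
    maximum. *)
Lemma marginS (R : realType) (T : R) (k : nat) :
  0 <= T -> margin T k.+1 = 2 ^+ k * T.
Proof.
move=> T0; suff [] : margin T k.+1 = 2 ^+ k * T /\ T <= 2 ^+ k * T by [].
elim: k => [|k [IH Tk]]; first by rewrite /= mulr0 add0r mul1r max_r.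
move: IH; rewrite [margin T k.+2]/= -/(margin T k.+1) => ->; rewrite exprS.
rewrite max_l; lra.
Qed.

(** If the algorithm serves nothing, the adversary stops with performance 0; otherwise it plays
    another round. *)
Lemma trapped_performance (R : realType) (T : R) alg (k : nat)
    (J : seq (request R)) q :
  online_algorithm alg -> 0 <= T -> trapped T alg (margin T k) J q ->
  exists2 I, instances (size J + k.+1) T I &
    performance alg I <= 1 / (size J + k.+1)%:R.
Proof.
move=> oalg T0; elim: k J q => [|k IH] J q trap.
  have [iI wI _ _ _] := trap; exists (rcons J q); rewrite addn1//.
  by rewrite /performance wI ler_pM2r ?invr_gt0// (trapped_end oalg trap).
have [sw|sw] := ltP 0 (served_weight (alg (rcons J q)) (rcons J q)).
  have [|||q' trap'] := trapped_step (e := margin T k) oalg T0 _ _ _ trap sw.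
  - exact: margin_ge0.
  - by rewrite /= le_max lexx.
  - by rewrite /= le_max lexx orbT.
  by have := IH _ _ trap'; rewrite size_rcons addSnnS.
have [[vI /andP[I0 In] gI] _ _ _ _] := trap; exists (rcons J q).
  by split=> //; rewrite I0 (leq_trans In)// addnS ltnS leq_addr.
have -> : performance alg (rcons J q) = 0.
  rewrite /performance -/(served_weight _ _).
  suff -> : served_weight (alg (rcons J q)) (rcons J q) = 0 by rewrite mul0r.
  by apply/le_anti; rewrite sw sum_weight_ge0//; case/andP: vI.
by rewrite divr_ge0.
Qed.

(** The vehicle starts at 0, so it is within [T] of 0 at time [T] and reaches 1 no earlier than time
    1, which is after [T]. *)
Lemma trapped_init (R : realType) (T e : R) alg :
  online_algorithm alg -> 0 <= T -> 0 <= e -> e + T < 1 ->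
  trapped T alg e [:: Request 1 0 1] (Request (-1) T 1).
Proof.
move=> [talg _] T0 e0 eT.
have vI : input_valid [:: Request 1 0 1; Request (-1) T 1].
  by rewrite /input_valid /= /request_valid /= T0 !lexx ltr01 /= andbT; lra.
split=> /=.
- by split=> //=; rewrite subr0 lexx.
- by rewrite !big_cons big_nil /= addr0.
- by rewrite normrN normr1.
- have := trajectory_le (talg _ vI) (lexx 0) T0; case: (talg _ vI) => -> _ _.
  by rewrite !subr0; lra.
move=> y ty yx; rewrite /served_weight big_cons big_nil /= addr0.
case: asboolP => [[t /= /andP[t0 t2] yt]|_]; last by rewrite ler01 ltxx.
split=> // _; exists t; last by rewrite opprK.
have := trajectory_le ty (lexx 0) t0; case: ty => -> _ _.
by rewrite subr0 yt normr1; lra.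
Qed.

(** * The optimal value *)

Lemma performance_bounds (R : realType) alg (I : seq (request R)) :
  all (@request_valid R) I -> 0 <= performance alg I <= 1.
Proof.
move=> vI; have S0 := sum_weight_ge0 (fun q => `[< served (alg I) q >]) vI.
case: I vI S0 => [|q I] vI S0; first by rewrite /performance !big_nil mul0r lexx ler01.
have W0 := total_weight_gt0 vI isT.
rewrite /performance divr_ge0 ?(ltW W0)//= ler_pdivrMr// mul1r.
move: (alg (q :: I)) => x.
elim: (q :: I) vI => {q I S0 W0} [|q I IH]; first by rewrite !big_nil.
rewrite !big_cons => /= /andP[/and3P[_ _ wq] /IH le_I].
by case: ifP => _; [rewrite lerD2l | apply: le_trans le_I _; rewrite lerDr ltW].
Qed.

(** For [n = 1] any instance will do. For [n = k + 2] the game can start when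
    [margin T k + T < 1]. *)
Lemma adversary (R : realType) (n : nat) (T : R) alg :
  (1 <= n)%N -> 0 <= T -> T < 1 / ((2 : R) ^ (n%:Z - 3) + 1) ->
  online_algorithm alg ->
  exists2 I, instances n T I & performance alg I <= 1 / n%:R.
Proof.
move=> n1 T0 TT oalg; case: n n1 TT => [|[|k]]// _ TT.
  have [I iI] := instances_nonempty T (ltnSn 0); exists I => //; rewrite divr1.
  by have [/andP[vI _] _ _] := iI; case/andP: (performance_bounds alg vI).
apply: (trapped_performance (k := k) (J := [:: Request 1 0 1]) (q := Request (-1) T 1)) => //.
apply: trapped_init => //; first exact: margin_ge0.
move: TT; case: k => [|k].
  (* For [n = 2] the hypothesis reads [T < 2/3], while [T < 1] suffices. *)
  rewrite add0r; have -> : (2%:Z - 3 = -1)%R by [].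
  rewrite exprN1 => /lt_trans; apply.
  rewrite ltr_pdivrMr; lra.
rewrite marginS//; have -> : (k.+3%:Z - 3 = k%:Z)%R by rewrite -[k.+3]addn3 PoszD addrK.
have p0 : 0 < (2 : R) ^+ k by rewrite exprn_gt0.
rewrite ltr_pdivlMr; last by rewrite addr_gt0.
by rewrite -exprnP mulrDr mulr1 mulrC.
Qed.

Theorem theorem3 (R : realType) (n : nat) (T : R) :
  (1 <= n)%N -> 0 <= T -> T < 1 / ((2 : R) ^ (n%:Z - 3) + 1) ->
  opt_value n T = 1 / n%:R.
Proof.
move=> n1 T0 TT.
have upper v : [set alg_value n T alg | alg in @online_algorithm R]%classic v ->
    v <= 1 / n%:R.
  move=> [alg oalg <-]; have [I iI pI] := adversary n1 T0 TT oalg.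
  apply: le_trans pI; apply: ge_inf; last by exists I.
  by exists 0 => _ [J [/andP[vJ _] _ _] <-]; case/andP: (performance_bounds alg vJ).
have og := online_greedy R.
apply/le_anti/andP; split.
  by apply: ge_sup => //; eexists; exists (fun I => (greedy I).1).
apply: (@le_trans _ _ (alg_value n T (fun I : seq (request R) => (greedy I).1))).
  apply: lb_le_inf; first by have [I iI] := instances_nonempty T n1; eexists; exists I.
  by move=> _ [I iI <-]; exact: performance_greedy iI.
by apply: ub_le_sup; [exists (1 / n%:R) | exists (fun I => (greedy I).1)].
Qed.
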